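(* The overlapping little $1$-cubes operad $\mathcal{O}^{\Xi}_1$ has a natural coaction on the geometric realization $|Z_\bullet|$ of a simplicial space $Z_\bullet$ such that the composite coaction of the commutative operad $\mathcal{C}om$ is the set of diagonal maps, and the composite coaction of the little $1$-cubes operad $\mathcal{C}_1$, $$|Z_\bullet|\times\mathcal{C}_1(n)\longrightarrow|Z_\bullet|^n,$$ is filtered for the simplicial filtration on $|Z_\bullet|$ (where the target $|Z_\bullet|^n$ is given the cartesian product filtration, not the simplicial filtration of $|Z_\bullet^n|$).
   Context: Let $I=[0,1]$. The overlapping little $1$-cubes operad $\mathcal{O}^{\Xi}_1$ has $n$-th space the subspace of elements $((x_1,y_1),\dots,(x_n,y_n))$ of $(I^2)^n$ satisfying $x_i<y_i$ for all $i$, with $\Sigma_n$ permuting the factors. Identify $(x,y)$ with the increasing linear map $f_{(x,y)}\colon I\to I$, $f_{(x,y)}(t)=x+(y-x)t$; the operadic composition is $$(f_1,\dots,f_n)\circ_i(f'_1,\dots,f'_{n'})=(f_1,\dots,f_{i-1},f_i\circ f'_1,\dots,f_i\circ f'_{n'},f_{i+1},\dots,f_n).$$ The commutative operad $\mathcal{C}om$ (each $\mathcal{C}om(n)$ a point) maps to $\mathcal{O}^{\Xi}_1$ by the points $((0,1),\dots,(0,1))$. The little $1$-cubes operad $\mathcal{C}_1$ maps to $\mathcal{O}^{\Xi}_1$ as the subspaces where the open intervals $(x_1,y_1),\dots,(x_n,y_n)$ are pairwise disjoint. For a space $X$, the mapping spaces $\mathrm{End}^{op}_X(n)=\mathrm{Map}(X,X^n)$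 form an operad; a coaction of an operad $\mathcal{O}$ on $X$ is a map of operads $\mathcal{O}\to\mathrm{End}^{op}_X$. The diagonal maps $X\to X^n$ define a coaction of $\mathcal{C}om$ on any space $X$. The simplicial filtration on $|Z_\bullet|$ has $n$-th level the image of $Z_n\times\Delta[n]$ (together with lower simplices); the cartesian product filtration on $|Z_\bullet|^m$ has $n$-th level the union over $n_1+\cdots+n_m\le n$ of the products of the $n_i$-th levels. *)

(* Defs.v *)
From HB Require Import structures.
From mathcomp Require Import all_boot all_order all_algebra perm.
From mathcomp Require Import all_classical all_reals topology.
From mathcomp Require Import zify ring lra.
From Stdlib Require Import Relations.Relation_Operators.

Set Implicit Arguments.
Unset Strict Implicit.
Unset Printing Implicit Defensive.

Import Order.TTheory GRing.Theory Num.Theory.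
Import numFieldTopology.Exports.

Local Open Scope classical_set_scope.
Local Open Scope ring_scope.
Local Open Scope quotient_scope.

(* Positions in (f_0, .., f_(i-1), g_0, .., g_(m-1), f_(i+1), .., f_n):
   [inl l] is the slot of f_l (never l = i), [inr j] the slot of g_j.
   [insub (k - i)] is [Some j] exactly when k - i < m. *)
Definition splice_index n m (i : 'I_n.+1) (k : 'I_(n + m)) : 'I_n.+1 + 'I_m :=
  if (k < i)%N then inl (inord k)
  else if insub (k - i)%N is Some j then inr j
  else inl (inord (k - m).+1).

Definition splice T n m (i : 'I_n.+1) (f : 'I_n.+1 -> T) (g : 'I_m -> T) :
    {ptws 'I_(n + m) -> T} :=
  fun k => match splice_index i k with inl l => f l | inr j => g j end.

Variant splice_index_spec n m (i : 'I_n.+1) (k : 'I_(n + m)) :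
    'I_n.+1 + 'I_m -> Prop :=
  | SpliceBefore (l : 'I_n.+1) of (k < i)%N & (l = k :> nat) :
      splice_index_spec i k (inl l)
  | SpliceIn (j : 'I_m) of (k = i + j :> nat)%N : splice_index_spec i k (inr j)
  | SpliceAfter (l : 'I_n.+1) of (i + m <= k)%N & (l + m = k.+1)%N :
      splice_index_spec i k (inl l).

Lemma splice_indexP n m (i : 'I_n.+1) (k : 'I_(n + m)) :
  splice_index_spec i k (splice_index i k).
Proof.
rewrite /splice_index; have kn := ltn_ord k; have vn := ltn_ord i.
case: ltnP => ki; first by apply: SpliceBefore => //; rewrite inordK; lia.
case: insubP => [j _ jE|]; first by apply: SpliceIn; rewrite jE; lia.
by rewrite -leqNgt => km; apply: SpliceAfter; rewrite ?inordK; lia.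
Qed.

Lemma splice_index_inj n m (i : 'I_n.+1) : injective (@splice_index n m i).
Proof.
move=> k k'; case: (splice_indexP i k) => [l ? ?|j ?|l ? ?];
  case: (splice_indexP i k') => [l' ? ?|j' ?|l' ? ?] // [] E;
  by apply: val_inj => /=; subst; lia.
Qed.

Lemma splice_index_neq n m (i l : 'I_n.+1) (k : 'I_(n + m)) :
  splice_index i k = inl l -> l != i.
Proof.
case: splice_indexP => // l' H1 H2 [<-]; apply/eqP => l'E; subst l'; lia.
Qed.

(* The data that a map of operads preserves, without the operad axioms:
   [op_comp a i b] is the partial composition a o_i b, of arity
   n + m = (n + 1) + m - 1, and [op_perm] permutes the inputs. *)
Record operad_data := OperadData {
  op_space :> nat -> topologicalType;
  op_unit : op_space 1;
  op_comp : forall n m,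
    op_space n.+1 -> 'I_n.+1 -> op_space m -> op_space (n + m);
  op_perm : forall n, 'S_n -> op_space n -> op_space n }.

Record operad_map (O P : operad_data) := OperadMap {
  om_fun :> forall n, O n -> P n;
  om_continuous : forall n, continuous (@om_fun n);
  om_unit : om_fun (op_unit O) = op_unit P;
  om_comp : forall n m (a : O n.+1) (i : 'I_n.+1) (b : O m),
    om_fun (op_comp a i b) = op_comp (om_fun a) i (om_fun b);
  om_perm : forall n (s : 'S_n) (a : O n),
    om_fun (op_perm s a) = op_perm s (om_fun a) }.

Program Definition operad_map_comp O P Q (g : operad_map P Q)
    (f : operad_map O P) : operad_map O Q :=
  @OperadMap O Q (fun n a => g n (f n a)) _ _ _ _.
Next Obligation.
move=> O P Q g f n x; apply: continuous_comp; exact: om_continuous.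
Qed.
Next Obligation. by move=> O P Q g f /=; rewrite !om_unit. Qed.
Next Obligation. by move=> O P Q g f n m a i b /=; rewrite !om_comp. Qed.
Next Obligation. by move=> O P Q g f n s a /=; rewrite !om_perm. Qed.

Definition mapping_space (X Y : topologicalType) : Type := continuousType X Y.

HB.instance Definition _ (X Y : topologicalType) :=
  Topological.copy (mapping_space X Y)
    (initial_topology
       (fun f : continuousType X Y => (f : {compact-open, X -> Y}))).

Definition mapping_fun (X Y : topologicalType) (f : mapping_space X Y) :
  X -> Y := (f : continuousType X Y).

Lemma mapping_fun_continuous (X Y : topologicalType) (f : mapping_space X Y) :
  continuous (mapping_fun f).
Proof. exact: cts_fun. Qed.

Definition mk_mapping (X Y : topologicalType) (f : X -> Y)
  (f_cts : continuous f) : mapping_space X Y := mkcts f_cts.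

Lemma ptws_continuous (X Y : topologicalType) (I : eqType)
    (f : X -> {ptws I -> Y}) :
  (forall i, continuous (fun x => f x i)) -> continuous f.
Proof.
move=> fc x; apply/cvg_sup => i.
exact: (@continuous_comp_initial _ _ _ (fun g : I -> Y => g i) f (fc i) x).
Qed.

Lemma ptws_eval_continuous (Y : topologicalType) (I : eqType) (i : I) :
  continuous (fun f : {ptws I -> Y} => f i).
Proof. exact: (@proj_continuous I (fun=> Y) i). Qed.

Section Endop.
Variable X : topologicalType.

Definition endop_space n : topologicalType :=
  mapping_space X {ptws 'I_n -> X}.

Definition endop_unit_fun (x : X) : {ptws 'I_1 -> X} := fun=> x.

Lemma endop_unit_continuous : continuous endop_unit_fun.
Proof. by apply: ptws_continuous => i x; exact: cvg_id. Qed.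

(* The operad reverses composition of self-maps of X: for n = m = 1,
   f o_1 g is g \o f. *)
Definition endop_comp_fun n m (f : endop_space n.+1) (i : 'I_n.+1)
    (g : endop_space m) (x : X) : {ptws 'I_(n + m) -> X} :=
  splice i (mapping_fun f x) (mapping_fun g (mapping_fun f x i)).

Lemma endop_coord_continuous n (f : endop_space n) i :
  continuous (fun x => mapping_fun f x i).
Proof.
move=> x; apply: (@continuous_comp _ _ _ (mapping_fun f) (fun h => h i)).
  exact: mapping_fun_continuous.
exact: ptws_eval_continuous.
Qed.

Lemma endop_comp_continuous n m (f : endop_space n.+1) i (g : endop_space m) :
  continuous (endop_comp_fun f i g).
Proof.
apply: ptws_continuous => k; rewrite /endop_comp_fun /splice.
case: (splice_index i k) => [l|j] x; first exact: endop_coord_continuous.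
apply: (@continuous_comp _ _ _ (fun x => mapping_fun f x i)
  (fun y => mapping_fun g y j)); exact: endop_coord_continuous.
Qed.

Definition endop_perm_fun n (s : 'S_n) (f : endop_space n) (x : X) :
  {ptws 'I_n -> X} := fun i => mapping_fun f x (s i).

Lemma endop_perm_continuous n s (f : endop_space n) :
  continuous (endop_perm_fun s f).
Proof.
by apply: ptws_continuous => i; exact: endop_coord_continuous.
Qed.

Definition Endop : operad_data := @OperadData endop_space
  (mk_mapping endop_unit_continuous)
  (fun n m f i g => mk_mapping (@endop_comp_continuous n m f i g))
  (fun n s f => mk_mapping (@endop_perm_continuous n s f)).

End Endop.

(* In a convenient category of spaces, continuity of O(n) -> Map(X, X^n) and of
   its adjoint X x O(n) -> X^n are the same condition; for arbitrary
   topological spaces the adjoint form is the stronger one. *)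
Record coaction (O : operad_data) (X : topologicalType) := Coaction {
  co_map :> operad_map O (Endop X);
  co_adjoint_continuous : forall n,
    continuous (fun p : X * O n => mapping_fun (co_map n p.2) p.1) }.

Definition coact O X (th : coaction O X) n (x : X) (a : O n) :
  {ptws 'I_n -> X} := mapping_fun (th n a) x.

Program Definition coaction_comp O P X (th : coaction P X)
    (f : operad_map O P) : coaction O X :=
  @Coaction O X (operad_map_comp th f) _.
Next Obligation.
move=> O P X th f n p.
apply: (@continuous_comp _ _ _ (fun p : X * O n => (p.1, f n p.2))
  (fun p : X * P n => mapping_fun (th n p.2) p.1)).
  apply: cvg_pair; first exact: cvg_fst.
  apply: continuous_comp; [exact: cvg_snd | exact: om_continuous].
exact: co_adjoint_continuous.
Qed.

Definition Com : operad_data := @OperadData (fun=> discrete_topology unit)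
  tt (fun _ _ _ _ _ => tt) (fun _ _ _ => tt).

Section LittleCubes.
Variable R : realType.

Definition incr_map (p : R * R) (t : R) : R := p.1 + (p.2 - p.1) * t.

Definition incr_comp (p q : R * R) : R * R := (incr_map p q.1, incr_map p q.2).

Lemma incr_compE p q : incr_map (incr_comp p q) = incr_map p \o incr_map q.
Proof. by apply/funext => t; rewrite /incr_comp /incr_map /=; ring. Qed.

Definition is_interval (p : R * R) : Prop :=
  [/\ 0 <= p.1, p.1 < p.2 & p.2 <= 1].

Definition overlapping_cubes n : set {ptws 'I_n -> (R * R)%type} :=
  [set c | forall i, is_interval (c i)].

Definition overlapping_space n : topologicalType :=
  set_type (@overlapping_cubes n).

Definition cubes n (c : overlapping_space n) : {ptws 'I_n -> (R * R)%type} :=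
  set_val c.

Lemma overlapping_spaceP n (c : overlapping_space n) i :
  is_interval (cubes c i).
Proof. by have /set_mem cP := svalP c; exact: cP. Qed.

Lemma id_cubes_subproof n : @overlapping_cubes n (fun=> (0, 1)).
Proof. by move=> i; split => //=; exact: ltr01. Qed.

Definition overlapping_unit : overlapping_space 1 :=
  SigSub (mem_set (@id_cubes_subproof 1)).

Definition overlapping_comp_fun n m (c : overlapping_space n.+1) (i : 'I_n.+1)
    (d : overlapping_space m) : {ptws 'I_(n + m) -> (R * R)%type} :=
  splice i (cubes c) (fun j => incr_comp (cubes c i) (cubes d j)).

Lemma incr_comp_sub p q : is_interval p -> is_interval q ->
  p.1 <= (incr_comp p q).1 /\ (incr_comp p q).2 <= p.2.
Proof.
case: p q => x y [x' y'] [/= x0 xy y1] [/= x'0 xy' y'1].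
rewrite /incr_map /=; split.
  by rewrite lerDl mulr_ge0// subr_ge0 ltW.
have : (y - x) * y' <= y - x by rewrite ler_piMr// subr_ge0 ltW.
lra.
Qed.

Lemma incr_comp_interval p q :
  is_interval p -> is_interval q -> is_interval (incr_comp p q).
Proof.
move=> pI qI; have [le1 le2] := incr_comp_sub pI qI.
case: pI qI => p0 p12 p1 [q0 q12 q1]; split.
- exact: le_trans le1.
- by rewrite /incr_comp /incr_map /= ltrD2l ltr_pM2l// subr_gt0.
- exact: le_trans p1.
Qed.

Lemma overlapping_comp_subproof n m c i d :
  overlapping_cubes (@overlapping_comp_fun n m c i d).
Proof.
move=> k; rewrite /overlapping_comp_fun /splice.
case: (splice_index i k) => [l|j]; first exact: overlapping_spaceP.
by apply: incr_comp_interval; exact: overlapping_spaceP.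
Qed.

Definition overlapping_comp n m c i d : overlapping_space (n + m) :=
  SigSub (mem_set (@overlapping_comp_subproof n m c i d)).

Lemma overlapping_perm_subproof n (s : 'S_n) (c : overlapping_space n) :
  overlapping_cubes (fun i => cubes c (s i)).
Proof. by move=> i; exact: overlapping_spaceP. Qed.

Definition overlapping_perm n s c : overlapping_space n :=
  SigSub (mem_set (@overlapping_perm_subproof n s c)).

Definition Overlapping : operad_data :=
  @OperadData overlapping_space overlapping_unit overlapping_comp
    overlapping_perm.

Definition disjoint_cubes n : set (overlapping_space n) :=
  [set c | trivIset [set: 'I_n]
    (fun i => `](cubes c i).1, (cubes c i).2[%classic)].

Definition little_space n : topologicalType := set_type (@disjoint_cubes n).

Definition little_incl n (c : little_space n) : overlapping_space n :=
  set_val c.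

Lemma little_spaceP n (c : little_space n) : disjoint_cubes (little_incl c).
Proof. by have /set_mem cP := svalP c; exact: cP. Qed.

Lemma little_space_inj n (c : little_space n) i j u :
  `](cubes (little_incl c) i).1, (cubes (little_incl c) i).2[%classic u ->
  `](cubes (little_incl c) j).1, (cubes (little_incl c) j).2[%classic u ->
  i = j.
Proof.
by move=> iu ju; apply: (little_spaceP (c := c) (i := i) (j := j)) => //; exists u.
Qed.

Lemma little_unit_subproof : disjoint_cubes overlapping_unit.
Proof. by move=> i j _ _ _; rewrite !ord1. Qed.

Lemma little_comp_subproof n m (c : little_space n.+1) i (d : little_space m) :
  disjoint_cubes (overlapping_comp (little_incl c) i (little_incl d)).
Proof.
have sub j : let p := cubes (little_incl c) i in
    let q := incr_comp p (cubes (little_incl d) j) in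
    `]q.1, q.2[ `<=` `]p.1, p.2[%classic.
  have [le1 le2] := incr_comp_sub (overlapping_spaceP (little_incl c) i)
                                  (overlapping_spaceP (little_incl d) j).
  move=> p q u /=; rewrite !in_itv/= => /andP[u1 u2].
  by rewrite (le_lt_trans le1 u1) (lt_le_trans u2 le2).
have cI := overlapping_spaceP (little_incl c) i.
move=> k k' _ _ [u].
rewrite -[cubes (overlapping_comp _ _ _)]/(overlapping_comp_fun _ _ _).
rewrite /overlapping_comp_fun /splice.
case: (splice_index i k) (@splice_index_neq _ _ i ^~ k)
  (@splice_index_inj _ _ i k k') => [l|j] neq inj;
  case: (splice_index i k') (@splice_index_neq _ _ i ^~ k') inj
  => [l'|j'] neq' inj [] ku ku'; apply: inj.
- by congr inl; exact: (@little_space_inj _ c l l' u ku ku').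
- have li : l = i.
    by exact: (@little_space_inj _ c l i u ku (sub j' u ku')).
  by have := neq l erefl; rewrite li eqxx.
- have li : l' = i.
    by exact: (@little_space_inj _ c l' i u ku' (sub j u ku)).
  by have := neq' l' erefl; rewrite li eqxx.
- congr inr.
  set p := cubes (little_incl c) i in cI ku ku'.
  have p12 : 0 < p.2 - p.1 by rewrite subr_gt0; case: cI.
  have pre (q : R * R) : `](incr_comp p q).1, (incr_comp p q).2[%classic u ->
      `]q.1, q.2[%classic ((u - p.1) / (p.2 - p.1)).
    rewrite /= /incr_map !in_itv/= => /andP[a b].
    by rewrite ltr_pdivlMr// ltr_pdivrMr// ltrBrDl ltrBlDl
      ![_ * (p.2 - p.1)]mulrC a b.
  exact: (@little_space_inj _ d _ _ _ (pre _ ku) (pre _ ku')).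
Qed.

Definition little_unit : little_space 1 := SigSub (mem_set little_unit_subproof).

Definition little_comp n m c i d : little_space (n + m) :=
  SigSub (mem_set (@little_comp_subproof n m c i d)).

Lemma little_perm_subproof n (s : 'S_n) (c : little_space n) :
  disjoint_cubes (overlapping_perm s (little_incl c)).
Proof.
move=> i j _ _ [u [iu ju]]; apply: (@perm_inj _ s).
exact: (@little_space_inj _ c _ _ u iu ju).
Qed.

Definition little_perm n s c : little_space n :=
  SigSub (mem_set (@little_perm_subproof n s c)).

Definition Little : operad_data :=
  @OperadData little_space little_unit little_comp little_perm.

Program Definition little_to_overlapping : operad_map Little Overlapping :=
  @OperadMap Little Overlapping little_incl _ _ _ _.
Next Obligation. by move=> n; exact: initial_continuous. Qed.
Next Obligation. by []. Qed.
Next Obligation. by []. Qed.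
Next Obligation. by []. Qed.

Program Definition com_to_overlapping : operad_map Com Overlapping :=
  @OperadMap Com Overlapping
    (fun n _ => SigSub (mem_set (@id_cubes_subproof n))) _ _ _ _.
Next Obligation. by move=> n x; exact: cvg_cst. Qed.
Next Obligation. exact: val_inj. Qed.
Next Obligation.
move=> n m a i b; apply: val_inj; apply/funext => k.
rewrite -[LHS]/(0, 1) -[RHS]/(splice i (fun=> (0, 1))
  (fun=> incr_comp (0, 1) (0, 1)) k) /splice.
case: (splice_index i k) => // _.
by rewrite /incr_comp /incr_map /= !(mulr0, mulr1, add0r, addr0, subr0).
Qed.
Next Obligation. by move=> n s a; exact: val_inj. Qed.

End LittleCubes.

Record simplicialSpace := SimplicialSpace {
  sobj :> nat -> topologicalType;
  smap : forall m n, {omorphism 'I_m.+1 -> 'I_n.+1} -> sobj n -> sobj m;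
  smap_continuous : forall m n (a : {omorphism 'I_m.+1 -> 'I_n.+1}),
    continuous (smap a);
  smap_id : forall n (z : sobj n), smap (@idfun 'I_n.+1) z = z;
  smap_comp : forall l m n (b : {omorphism 'I_m.+1 -> 'I_n.+1})
      (a : {omorphism 'I_l.+1 -> 'I_m.+1}) (z : sobj n),
    smap (b \o a) z = smap a (smap b z) }.

Record simplicialMap (Z W : simplicialSpace) := SimplicialMap {
  smor :> forall n, Z n -> W n;
  smor_continuous : forall n, continuous (@smor n);
  smor_natural : forall m n (a : {omorphism 'I_m.+1 -> 'I_n.+1}) (z : Z n),
    smor (smap a z) = smap a (smor z) }.

Section Realization.
Variable R : realType.

Definition barycentric n : set {ptws 'I_n.+1 -> R} :=
  [set t | (forall i, 0 <= t i) /\ \sum_i t i = 1].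

Definition simplex n : topologicalType := set_type (@barycentric n).

Definition coords n (t : simplex n) : {ptws 'I_n.+1 -> R} := set_val t.

Definition push_fun m n (a : 'I_m.+1 -> 'I_n.+1) (t : simplex m) :
  {ptws 'I_n.+1 -> R} := fun j => \sum_(i | a i == j) coords t i.

Lemma push_subproof m n (a : 'I_m.+1 -> 'I_n.+1) (t : simplex m) :
  barycentric (push_fun a t).
Proof.
have /set_mem [t0 t1] := svalP t; split => [j|].
  by apply: sumr_ge0 => i _; exact: t0.
by rewrite -[RHS]t1 [RHS](partition_big a xpredT).
Qed.

Definition push m n (a : 'I_m.+1 -> 'I_n.+1) (t : simplex m) : simplex n :=
  SigSub (mem_set (push_subproof a t)).

Section Quotient.
Variable Z : simplicialSpace.

Definition cell n : topologicalType := (Z n * simplex n)%type.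

Definition cells : topologicalType := {n : nat & cell n}.

Definition mk_cell n (z : Z n) (t : simplex n) : cells := existT cell n (z, t).

Inductive cell_step : cells -> cells -> Prop :=
  CellStep m n (a : {omorphism 'I_m.+1 -> 'I_n.+1}) (z : Z n) (t : simplex m) :
    cell_step (mk_cell (smap a z) t) (mk_cell z (push a t)).

Definition cell_rel (p q : cells) : bool :=
  `[< clos_refl_sym_trans cells cell_step p q >].

Lemma cell_rel_refl : reflexive cell_rel.
Proof. by move=> p; apply/asboolP; exact: rst_refl. Qed.

Lemma cell_rel_sym : ssrbool.symmetric cell_rel.
Proof. by move=> p q; apply/asboolP/asboolP; exact: rst_sym. Qed.

Lemma cell_rel_trans : ssrbool.transitive cell_rel.
Proof.
by move=> q p r /asboolP pq /asboolP qr; apply/asboolP; exact: rst_trans qr.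
Qed.

Canonical cell_equiv :=
  EquivRel cell_rel cell_rel_refl cell_rel_sym cell_rel_trans.

Definition realization : topologicalType :=
  quotient_topology {eq_quot cell_equiv}.

Definition rpoint n (z : Z n) (t : simplex n) : realization :=
  \pi_(quotient_topology {eq_quot cell_equiv}) (mk_cell z t).

Definition simplicial_filtration (k : nat) : set realization :=
  [set x | exists n (z : Z n) (t : simplex n), (n <= k)%N /\ x = rpoint z t].

Lemma rpoint_push m n (a : {omorphism 'I_m.+1 -> 'I_n.+1}) (z : Z n)
  (t : simplex m) : rpoint (smap a z) t = rpoint z (push a t).
Proof. by apply/eqmodP/asboolP; apply: rst_step; exact: CellStep. Qed.

End Quotient.

Definition realization_map Z W (F : simplicialMap Z W) (x : realization Z) :
    realization W :=
  let: existT n (z, t) := repr x in rpoint (F n z) t.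

Lemma realization_mapE Z W (F : simplicialMap Z W) n (z : Z n) t :
  realization_map F (rpoint z t) = rpoint (F n z) t.
Proof.
pose h (p : cells Z) := let: existT n (z, t) := p in rpoint (F n z) t.
have hE p q : clos_refl_sym_trans _ (@cell_step Z) p q -> h p = h q.
  elim=> [_ _ [m k a y s]|//|//|? ? ? _ -> _ ->//] /=.
  by rewrite smor_natural rpoint_push.
rewrite /realization_map -/(h _) [RHS](_ : _ = h (mk_cell z t))//.
have rK : \pi_{eq_quot cell_equiv Z} (repr (rpoint z t)) =
  \pi_{eq_quot cell_equiv Z} (mk_cell z t) by exact: reprK.
by apply: hE; apply/asboolP; move/eqmodP: rK.
Qed.

End Realization.

Definition product_filtration (X : Type) (F : nat -> set X) (m k : nat) :
    set {ptws 'I_m -> X} :=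
  [set x | exists p : 'I_m -> nat,
    (\sum_i p i <= k)%N /\ forall i, F (p i) (x i)].

Definition filtered_coaction O (X : topologicalType) (F : nat -> set X)
    (th : coaction O X) : Prop :=
  forall n k (x : X) (a : O n),
    F k x -> product_filtration F k (coact th x a).

Definition diagonal_coaction O (X : topologicalType) (th : coaction O X) : Prop :=
  forall n (x : X) (a : O n), coact th x a = (fun=> x).

Definition natural_coaction (R : realType) O
    (th : forall Z : simplicialSpace, coaction O (realization R Z)) : Prop :=
  forall Z W (F : simplicialMap Z W) n (x : realization R Z) (a : O n) i,
    coact (th W) (realization_map F x) a i =
    realization_map F (coact (th Z) x a i).

(* Main.v *)
Require Import Defs.
From HB Require Import structures.
From mathcomp Require Import all_boot all_order all_algebra.
From mathcomp Require Import all_classical all_reals topology.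
From mathcomp Require Import unstable normedtype.
From mathcomp Require Import ring lra.
From Stdlib Require Import Relations.Relation_Operators.
(* normedtype has its own is_interval. *)
Import Defs.

(* A point of the n-simplex is a sequence of cumulative sums
   0 = s_0 <= s_1 <= ... <= s_{n+1} = 1, and the simplicial operators act by
   reindexing this sequence. Hence any nondecreasing g : [0, 1] -> [0, 1] fixing
   0 and 1 acts on the realization by s |-> g o s. An interval (x, y) acts through
   the g that collapses [0, x] to 0 and [y, 1] to 1 and is linear in between;
   this g is a left inverse of f_(x,y), so composition is reversed and (0, 1) acts
   as the identity. The new point lies in the filtration level given by the
   number of k with s_k in ]x, y[, since the other cumulative sums become 0 or 1;
   for disjoint intervals these numbers add up to at most n. *)

Set Implicit Arguments.
Unset Strict Implicit.
Unset Printing Implicit Defensive.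

Import Order.TTheory GRing.Theory Num.Theory.
Import numFieldNormedType.Exports.

Local Open Scope classical_set_scope.
Local Open Scope ring_scope.
Local Open Scope quotient_scope.

(** * Product spaces *)

Lemma continuous_pair (T U V : topologicalType) (f : T -> U) (g : T -> V) x :
  {for x, continuous f} -> {for x, continuous g} ->
  {for x, continuous (fun y => (f y, g y))}.
Proof. exact: cvg_pair. Qed.

(** Applied to the parameter space [R * R] when uncurrying in [rescale_continuous]. *)
Lemma locally_compact_setX (U V : topologicalType) :
  locally_compact [set: U] -> locally_compact [set: V] ->
  locally_compact [set: U * V].
Proof.
move=> lcU lcV [u v] _; rewrite withinET.
have [A] := lcU u I; rewrite withinET => Au [cA clA].
have [B] := lcV v I; rewrite withinET => Bv [cB clB].
exists (A `*` B); first by exists (A, B).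
split; first exact: compact_setX.
rewrite (_ : A `*` B = fst @^-1` A `&` snd @^-1` B)//.
by apply: closedI; apply: preimage_closed => // x _; [exact: cvg_fst|exact: cvg_snd].
Qed.

(** * Collapse maps of the unit interval *)

Definition clamp (R : realType) (u : R) : R := Num.min (Num.max u 0) 1.

(* For p = (x, y) with 0 <= x < y <= 1, [collapse (collapse_param p)] is
   u |-> (u - x) / (y - x) truncated to [0, 1]. The detour through all of R * R
   makes the parameter space locally compact with no singularity at x = y; the
   inner min and max force every [collapse q] to fix 0 and 1. *)
Definition collapse (R : realType) (q : R * R) (u : R) : R :=
  clamp (Num.min q.1 0 + Num.max q.2 (1 - Num.min q.1 0) * u).

Definition collapse_param (R : realType) (p : R * R) : R * R :=
  (- p.1 / (p.2 - p.1), (p.2 - p.1)^-1).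

Lemma clamp_homo (R : realType) : {homo @clamp R : u v / u <= v}.
Proof. by move=> u v uv; rewrite /clamp le_min2// le_max2. Qed.

Lemma clamp_id (R : realType) (u : R) : 0 <= u <= 1 -> clamp u = u.
Proof. by case/andP => u0 u1; rewrite /clamp max_l// min_l. Qed.

Lemma clamp_le0 (R : realType) (u : R) : u <= 0 -> clamp u = 0.
Proof. by move=> u0; rewrite /clamp max_r// min_l. Qed.

Lemma clamp_ge1 (R : realType) (u : R) : 1 <= u -> clamp u = 1.
Proof. by move=> u1; rewrite /clamp max_l ?min_r//; exact: le_trans u1. Qed.

Lemma collapse_homo (R : realType) (q : R * R) :
  {homo collapse q : u v / u <= v}.
Proof.
move=> u v uv; apply: clamp_homo; rewrite lerD2l ler_wpM2l//.
by rewrite le_max orbC subr_ge0 ge_min ler01 orbT.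
Qed.

Lemma collapse0 (R : realType) (q : R * R) : collapse q 0 = 0.
Proof. by rewrite /collapse mulr0 addr0 clamp_le0// ge_min lexx orbT. Qed.

Lemma collapse1 (R : realType) (q : R * R) : collapse q 1 = 1.
Proof. by rewrite /collapse mulr1 clamp_ge1// -lerBlDl le_max lexx orbT. Qed.

(** On an interval the inner min and max are inactive: [-x/(y-x) <= 0] since [0 <= x], and
    [1 + x/(y-x) = y/(y-x) <= 1/(y-x)] since [y <= 1]. *)
Lemma collapse_paramE (R : realType) (p : R * R) (u : R) : is_interval p ->
  collapse (collapse_param p) u = clamp ((u - p.1) / (p.2 - p.1)).
Proof.
case: p => x y [/= x0 xy y1]; rewrite /collapse /=.
have d0 : 0 < y - x by rewrite subr_gt0.
rewrite min_l; last by rewrite mulNr oppr_le0 mulr_ge0// invr_ge0 ltW.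
rewrite max_l; last first.
  rewrite mulNr opprK -{1}(divff (lt0r_neq0 d0)) -mulrDl -[leRHS]mul1r.
  by rewrite ler_pM2r ?invr_gt0//; lra.
by congr clamp; rewrite mulrBl mulNr addrC mulrC.
Qed.

Lemma collapse_param_id (R : realType) (u : R) : 0 <= u <= 1 ->
  collapse (collapse_param (0, 1)) u = u.
Proof.
move=> uI; rewrite collapse_paramE /=; last by split => //=; exact: ltr01.
by rewrite subr0 subr0 divr1 clamp_id.
Qed.

Lemma collapse_param_comp (R : realType) (p q : R * R) (u : R) :
  is_interval p -> is_interval q ->
  collapse (collapse_param (incr_comp p q)) u =
  collapse (collapse_param q) (collapse (collapse_param p) u).
Proof.
move=> pI qI; rewrite !collapse_paramE//; last exact: incr_comp_interval.
case: p q pI qI => x y [x' y'] [/= x0 xy y1] [/= x'0 xy' y'1].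
rewrite /incr_comp /incr_map /=.
have d0 : 0 < y - x by rewrite subr_gt0.
have d'0 : 0 < y' - x' by rewrite subr_gt0.
(* Before truncation both sides are the same affine function of [u]. *)
have -> : (u - (x + (y - x) * x')) / (x + (y - x) * y' - (x + (y - x) * x'))
    = ((u - x) / (y - x) - x') / (y' - x').
  by field; rewrite !lt0r_neq0//=; nra.
(* The intermediate truncation is harmless: where [w] leaves [0, 1], both sides are already 0 or 1
   because [0 <= x'] and [y' <= 1]. *)
set w := (u - x) / (y - x).
have [w0|w0] := leP w 0.
  rewrite (clamp_le0 w0) !clamp_le0// pmulr_lle0 ?invr_gt0//; lra.
have [w1|w1] := leP 1 w.
  by rewrite (clamp_ge1 w1) !clamp_ge1// ler_pdivlMr// mul1r; lra.
by rewrite (clamp_id (u := w))// !ltW.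
Qed.

Lemma collapse_param_inside (R : realType) (p : R * R) (u : R) :
  is_interval p -> 0 < collapse (collapse_param p) u < 1 -> p.1 < u < p.2.
Proof.
move=> pI; rewrite collapse_paramE//; case: pI => _ p12 _.
have d0 : 0 < p.2 - p.1 by rewrite subr_gt0.
case: (leP u p.1) => [up|pu].
  by rewrite clamp_le0 ?ltxx// pmulr_lle0 ?invr_gt0// subr_le0.
case: (leP p.2 u) => [pu2|//].
by rewrite clamp_ge1 ?ltxx ?andbF// ler_pdivlMr// mul1r lerD2r.
Qed.

Lemma collapse_continuous (R : realType) :
  continuous (fun p : (R * R) * R => collapse p.1 p.2).
Proof.
move=> p; rewrite /collapse /clamp.
have c11 : continuous (fun p : (R * R) * R => p.1.1).
  by move=> r; apply: continuous_comp; exact: cvg_fst.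
have c12 : continuous (fun p : (R * R) * R => p.1.2).
  by move=> r; apply: continuous_comp; [exact: cvg_fst|exact: cvg_snd].
have mn (f g : (R * R) * R -> R) : {for p, continuous f} ->
    {for p, continuous g} -> {for p, continuous (fun r => Num.min (f r) (g r))}.
  exact: continuous_min.
have mx (f g : (R * R) * R -> R) : {for p, continuous f} ->
    {for p, continuous g} -> {for p, continuous (fun r => Num.max (f r) (g r))}.
  exact: continuous_max.
have cst (c : R) : {for p, continuous (fun _ : (R * R) * R => c)}.
  exact: cvg_cst.
have cm := mn _ _ (c11 p) (cst 0).
have cb := mx _ _ (c12 p) (continuousB (cst 1) cm).
have cs : {for p, continuous (fun r : (R * R) * R => r.2)} by exact: cvg_snd.
exact: mn (mx _ _ (continuousD cm (continuousM cb cs)) (cst 0)) (cst 1).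
Qed.

Lemma collapse_param_continuous (R : realType) (p : R * R) : is_interval p ->
  {for p, continuous (@collapse_param R)}.
Proof.
case=> _ p12 _; have d0 : p.2 - p.1 != 0 by rewrite subr_eq0 gt_eqF.
have cd : {for p, continuous (fun p : R * R => (p.2 - p.1)^-1)}.
  apply: continuousV => //.
  by apply: continuousB; [exact: cvg_snd|exact: cvg_fst].
apply: continuous_pair; last exact: cd.
by apply: continuousM => //; apply: continuousN; exact: cvg_fst.
Qed.

(** * Cumulative sums of barycentric coordinates *)

Lemma coords_ge0 (R : realType) n (t : simplex R n) i : 0 <= coords t i.
Proof. by have /set_mem [t0 _] := svalP t; exact: t0. Qed.

Lemma sum_coords (R : realType) n (t : simplex R n) : \sum_i coords t i = 1.
Proof. by have /set_mem [_ t1] := svalP t. Qed.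

Lemma simplex_eq (R : realType) n (t u : simplex R n) :
  (forall i, coords t i = coords u i) -> t = u.
Proof. by move=> tu; apply: val_inj; apply/funext. Qed.

Definition cum (R : realType) n (t : simplex R n) (k : nat) : R :=
  \sum_(i < n.+1 | (i < k)%N) coords t i.

Lemma cum0 (R : realType) n (t : simplex R n) : cum t 0 = 0.
Proof. by rewrite /cum big_pred0. Qed.

Lemma cum_full (R : realType) n (t : simplex R n) k :
  (n < k)%N -> cum t k = 1.
Proof.
move=> nk; rewrite -(sum_coords t); apply: eq_bigl => i.
by rewrite (leq_trans (ltn_ord i)).
Qed.

Lemma cumS (R : realType) n (t : simplex R n) (i : 'I_n.+1) :
  cum t i.+1 = cum t i + coords t i.
Proof.
rewrite /cum (bigD1 i)//= addrC; congr (_ + _); apply: eq_bigl => j.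
by rewrite ltnS ltn_neqAle andbC.
Qed.

Lemma cum_leS (R : realType) n (t : simplex R n) k :
  cum t k <= cum t k.+1.
Proof.
have [kn|nk] := ltnP k n.+1; last by rewrite (cum_full _ nk) (cum_full _ (leqW nk)).
by rewrite (cumS t (Ordinal kn)) lerDl coords_ge0.
Qed.

Lemma cum_itv (R : realType) n (t : simplex R n) k : 0 <= cum t k <= 1.
Proof.
apply/andP; split; first by apply: sumr_ge0 => i _; exact: coords_ge0.
rewrite -(sum_coords t) [leRHS](bigID (fun i : 'I_n.+1 => (i < k)%N)) /=.
by rewrite lerDl; apply: sumr_ge0 => i _; exact: coords_ge0.
Qed.

(** Coordinates are differences of consecutive cumulative sums, so identities between points of a
    simplex can be checked on [cum]. *)
Lemma cum_inj (R : realType) n (t u : simplex R n) : cum t =1 cum u -> t = u.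
Proof.
by move=> tu; apply: simplex_eq => i; have := tu i.+1; rewrite !cumS tu => /addrI.
Qed.

(** The preimage of an initial segment under a monotone map is an initial segment. The index [k']
    depends on [a] and [k] only, so it serves [t] and [resample q t] alike. *)
Lemma cum_push (R : realType) m n (a : {omorphism 'I_m.+1 -> 'I_n.+1}) k :
  exists k', forall t : simplex R m, cum (push a t) k = cum t k'.
Proof.
have [k' k'P] : exists k', forall i : 'I_m.+1, (a i < k)%N = (i < k')%N.
  (* [k'] is the least [i] with [k <= a i], or [m.+1] if there is none. *)
  have [aS|] := boolP [forall i, (a i < k)%N].
    by exists m.+1 => i; rewrite ltn_ord (forallP aS).
  rewrite negb_forall => /existsP [i0 i0P].
  have [j jP jmin] := @arg_minnP _ i0 (fun i => ~~ (a i < k)%N)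
    (fun i => nat_of_ord i) i0P.
  exists j => i; have [ij|ji] := ltnP i j.
    by apply: contraLR ij => /jmin; rewrite -leqNgt.
  by apply: contraNF jP; exact: leq_ltn_trans (omorph_le a ji).
exists k' => t; rewrite /cum -[coords _]/(push_fun a t) /push_fun.
rewrite [RHS](partition_big a (fun j : 'I_n.+1 => (j < k)%N)) /=; last first.
  by move=> i; rewrite k'P.
apply: eq_bigr => j jk; apply: eq_bigl => i.
by case: eqP => [E|]; rewrite ?andbF// andbT -k'P E.
Qed.

(** * Action of collapse maps on simplices *)

Definition resample_fun (R : realType) n (q : R * R) (t : simplex R n) :
    {ptws 'I_n.+1 -> R} :=
  fun i => collapse q (cum t i.+1) - collapse q (cum t i).

Lemma resample_subproof (R : realType) n (q : R * R) (t : simplex R n) :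
  barycentric (resample_fun q t).
Proof.
split => [i|]; first by rewrite subr_ge0; exact/collapse_homo/cum_leS.
rewrite /resample_fun.
rewrite -(big_mkord xpredT
  (fun i => collapse q (cum t i.+1) - collapse q (cum t i))).
rewrite telescope_sumr// cum_full// cum0 collapse0 subr0.
exact: collapse1.
Qed.

Definition resample (R : realType) n (q : R * R) (t : simplex R n) :
  simplex R n := SigSub (mem_set (resample_subproof q t)).

Lemma cum_resample (R : realType) n (q : R * R) (t : simplex R n) :
  cum (resample q t) =1 collapse q \o cum t.
Proof.
elim=> [|k IH] /=; first by rewrite !cum0 collapse0.
have [kn|nk] := ltnP k n.+1; last first.
  by rewrite !(cum_full _ (leqW nk)) collapse1.
rewrite (cumS _ (Ordinal kn)) IH /= -[coords _]/(resample_fun q t).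
by rewrite /resample_fun /= addrC subrK.
Qed.

Lemma resample_push (R : realType) m n q (a : {omorphism 'I_m.+1 -> 'I_n.+1})
    (t : simplex R m) :
  resample q (push a t) = push a (resample q t).
Proof.
apply: cum_inj => k; have [k' k'P] := cum_push R a k.
by rewrite cum_resample /= !k'P cum_resample.
Qed.

Lemma resample_id (R : realType) n (t : simplex R n) :
  resample (collapse_param (0, 1)) t = t.
Proof.
by apply: cum_inj => k; rewrite cum_resample /= collapse_param_id// cum_itv.
Qed.

Lemma resample_comp (R : realType) n (p q : R * R) (t : simplex R n) :
  is_interval p -> is_interval q ->
  resample (collapse_param (incr_comp p q)) t =
  resample (collapse_param q) (resample (collapse_param p) t).
Proof.
move=> pI qI; apply: cum_inj => k.
by rewrite !cum_resample /= cum_resample /= collapse_param_comp.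
Qed.

Lemma resample_continuous (R : realType) n :
  continuous (fun p : simplex R n * (R * R) => resample p.2 p.1).
Proof.
apply: continuous_comp_initial; apply: ptws_continuous => i p.
have ccum k : continuous (fun p : simplex R n * (R * R) => cum p.1 k).
  apply: continuous_big; first exact: add_continuous.
  move=> j _ {}p; apply: (@continuous_comp _ _ _ fst (fun t => coords t j)).
    exact: cvg_fst.
  apply: (@continuous_comp _ _ _ (@coords R n) (fun f => f j)).
    exact: initial_continuous.
  exact: ptws_eval_continuous.
have cc k : {for p, continuous (fun p : simplex R n * (R * R) =>
    collapse p.2 (cum p.1 k))}.
  apply: (@continuous_comp _ _ _
    (fun p : simplex R n * (R * R) => (p.2, cum p.1 k))
    (fun p : (R * R) * R => collapse p.1 p.2)).
    by apply: continuous_pair; [exact: cvg_snd|exact: ccum].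
  exact: (@collapse_continuous R (p.2, cum p.1 k)).
exact: (continuousB (cc i.+1) (cc i)).
Qed.

(** * Action on the realization and its continuity *)

(** Defined on a chosen representative; [rescaleE] gives independence of the choice. *)
Definition rescale (R : realType) (Z : simplicialSpace) (q : R * R)
    (x : realization R Z) : realization R Z :=
  let: existT n (z, t) := repr x in rpoint z (resample q t).

(** Invariance under the generating steps extends to the equivalence relation they generate, which
    relates a cell to the representative of its class. *)
Lemma realization_lift (R : realType) (Z : simplicialSpace) T
    (h : cells R Z -> T) :
  (forall p q, cell_step p q -> h p = h q) ->
  forall n (z : Z n) t, h (repr (rpoint z t)) = h (mk_cell z t).
Proof.
move=> hstep n z t.
have hE p q : clos_refl_sym_trans _ (@cell_step R Z) p q -> h p = h q.
  by elim=> [? ? /hstep|//|//|? ? ? _ -> _ ->].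
have rK : \pi_{eq_quot cell_equiv R Z} (repr (rpoint z t)) =
  \pi_{eq_quot cell_equiv R Z} (mk_cell z t) by exact: reprK.
by apply: hE; apply/asboolP; move/eqmodP: rK.
Qed.

Lemma rescaleE (R : realType) (Z : simplicialSpace) (q : R * R) n (z : Z n) t :
  rescale q (rpoint z t) = rpoint z (resample q t).
Proof.
pose h (p : cells R Z) := let: existT n (z, t) := p in rpoint z (resample q t).
apply: (realization_lift (h := h)) => _ _ [m k a y s] /=.
by rewrite resample_push rpoint_push.
Qed.

Lemma realization_ind (R : realType) (Z : simplicialSpace)
    (P : realization R Z -> Prop) :
  (forall n (z : Z n) t, P (rpoint z t)) -> forall x, P x.
Proof.
move=> PP x; rewrite -[x]reprK; case: (repr x) => n [z t]; exact: PP.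
Qed.

(* Multiplying by the locally compact space R * R preserves the quotient map from
   the cells (Whitehead): curry, descend to the quotient, uncurry. *)
Lemma rescale_continuous (R : realType) (Z : simplicialSpace) :
  continuous (fun p : realization R Z * (R * R) => rescale p.2 p.1).
Proof.
pose h (x : realization R Z) : {compact-open, (R * R)%type -> realization R Z} :=
  fun q => rescale q x.
pose g n (p : cell R Z n * (R * R)) := rpoint p.1.1 (resample p.2 p.1.2).
have gc n : continuous (@g n).
  move=> p; apply: (@continuous_comp _ _ _
    (fun p : cell R Z n * (R * R) => mk_cell p.1.1 (resample p.2 p.1.2))
    (\pi_(realization R Z))); last exact: pi_continuous.
  apply: (@continuous_comp _ _ _
    (fun p : cell R Z n * (R * R) => (p.1.1, resample p.2 p.1.2))
    (existT (cell R Z) n)); last exact: existT_continuous.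
  apply: continuous_pair; first by apply: continuous_comp; exact: cvg_fst.
  apply: (@continuous_comp _ _ _
    (fun p : cell R Z n * (R * R) => (p.1.2, p.2))
    (fun p : simplex R n * (R * R) => resample p.2 p.1)).
    apply: continuous_pair; last exact: cvg_snd.
    by apply: continuous_comp; [exact: cvg_fst|exact: cvg_snd].
  exact: resample_continuous.
have hc : continuous h.
  apply/quotient_continuous.
  rewrite (_ : _ \o _ = sigT_fun (fun n => curry (@g n) :
      cell R Z n -> {compact-open, (R * R)%type -> realization R Z})).
    by apply: sigT_continuous => n; exact: continuous_curry_fun.
  by apply/funext => -[n [z t]]; apply/funext => q; exact: rescaleE.
(* The compact-open topology is put on all functions, so continuity of each [h x] is a separate
   condition for uncurrying. *)
have hp x : continuous (h x).
  move: x; apply: realization_ind => n z t.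
  rewrite (_ : h _ = curry (@g n) (z, t)).
    by have [_] := continuous_curry (gc n); exact.
  by apply/funext => q; exact: rescaleE.
have -> : (fun p : realization R Z * (R * R) => rescale p.2 p.1) = uncurry h.
  by apply/funext => -[].
apply: continuous_uncurry => //.
by apply: locally_compact_setX; exact: locally_compactR.
Qed.

(** * Faces and the simplicial filtration *)

(** The j-th coface map, named so that an order-morphism structure can be attached to it. *)
Definition lift_omorphism n (j : 'I_n.+1) : 'I_n -> 'I_n.+1 := lift j.

Lemma lift_omorphism_le n (j : 'I_n.+1) :
  {homo @lift_omorphism n j : i k / (i <= k)%O}.
Proof. by move=> i k ik; rewrite /lift_omorphism leEord /= leq_bump2. Qed.

HB.instance Definition _ n (j : 'I_n.+2) :=
  Order.isOrderMorphism.Build _ _ _ _ (@lift_omorphism n.+1 j)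
    (@lift_omorphism_le n.+1 j).

Lemma face_subproof (R : realType) n (t : simplex R n.+1) (j : 'I_n.+2) :
  coords t j = 0 ->
  barycentric (fun i => coords t (lift j i) : R).
Proof.
move=> tj; split => [i|]; first exact: coords_ge0.
by rewrite -(sum_coords t) (bigD1_ord j)//= tj add0r.
Qed.

Definition face (R : realType) n (t : simplex R n.+1) (j : 'I_n.+2)
    (tj : coords t j = 0) : simplex R n :=
  SigSub (mem_set (face_subproof tj)).

Lemma push_face (R : realType) n (t : simplex R n.+1) (j : 'I_n.+2)
    (tj : coords t j = 0) :
  push (lift_omorphism j) (face tj) = t.
Proof.
apply: simplex_eq => k; rewrite -[LHS]/(push_fun _ _ k) /push_fun.
case: (unliftP j k) => [i ->|->].
  rewrite (eq_bigl (pred1 i)) ?big_pred1_eq// => i'.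
  by rewrite /lift_omorphism (inj_eq lift_inj).
rewrite big_pred0 ?tj// => i; apply/negbTE.
by rewrite eq_sym neq_lift.
Qed.

(** A zero coordinate puts [t] on a face, so [z] can be replaced by its face in dimension one lower
    without changing the number of nonzero coordinates; induction on [n] repeats this down to
    dimension [p]. *)
Lemma rpoint_filtration (R : realType) (Z : simplicialSpace) p n (z : Z n)
    (t : simplex R n) :
  (\sum_i (coords t i != 0%R) <= p.+1)%N ->
  simplicial_filtration p (rpoint z t).
Proof.
elim: n z t => [|n IH] z t tp; first by exists 0%N, z, t.
have [np|pn] := leqP n.+1 p; first by exists n.+1, z, t.
(* Pigeonhole: there are n + 2 coordinates, at most p + 1 of them nonzero, and p < n + 1. *)
have [j /eqP tj] : exists j, coords t j == 0.
  apply/existsP; apply: contraLR pn; rewrite negb_exists => /forallP tn0.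
  rewrite -leqNgt -ltnS.
  apply: leq_trans tp; rewrite -[leqLHS]card_ord -sum1_card.
  by apply: leq_sum => i _; rewrite tn0.
have := rpoint_push (lift_omorphism j) z (face tj).
rewrite push_face => <-; apply: IH.
by apply: leq_trans tp; rewrite [leqRHS](bigD1_ord j)//= leq_addl.
Qed.

(* Every jump of v ends strictly inside ]0, 1[, except at most one that ends
   at 1. *)
Lemma sum_jumps (R : realType) (v : nat -> R) k :
  v 0 = 0 -> (forall i, v i <= v i.+1) -> (forall i, v i <= 1) ->
  (\sum_(i < k) (v i.+1 != v i) <=
   \sum_(i < k) (0 < v i.+1 < 1)%R + (v k == 1%R))%N.
Proof.
move=> v0 vle v1.
have vge0 i : 0 <= v i by elim: i => [|i IH]; [rewrite v0|exact: le_trans IH _].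
elim: k => [|k IH]; first by rewrite !big_ord0.
rewrite !big_ord_recr /=.
case: (eqVneq (v k.+1) (v k)) => [E|E].
  by rewrite addn0 E (leq_trans IH)// -addnA leq_add2l leq_addl.
(* A jump at [k] forces [v k < 1], so the boundary term of the induction hypothesis vanishes. *)
have vlt : v k < v k.+1 by rewrite lt_neqAle eq_sym E vle.
have vk1 : (v k == 1) = false by rewrite lt_eqF// (lt_le_trans vlt).
rewrite vk1 addn0 in IH.
rewrite -addnA leq_add// (le_lt_trans (vge0 k) vlt) /=.
by have := v1 k.+1; rewrite le_eqVlt => /orP[|] ->; rewrite ?addn1// addnC.
Qed.

Lemma rescale_filtration (R : realType) (Z : simplicialSpace) n (z : Z n)
    (t : simplex R n) (p : R * R) : is_interval p ->
  simplicial_filtration (\sum_(i < n) (p.1 < cum t i.+1 < p.2)%R)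
    (rescale (collapse_param p) (rpoint z t)).
Proof.
move=> pI; rewrite rescaleE; apply: rpoint_filtration.
pose v i := collapse (collapse_param p) (cum t i).
have v1 i : v i <= 1.
  rewrite -[leRHS](collapse1 (collapse_param p)); apply: collapse_homo.
  by case/andP: (cum_itv t i).
(* Nonzero coordinates of the resampled point are the jumps of [v]. *)
rewrite (eq_bigr (fun i : 'I_n.+1 => v i.+1 != v i : nat)); last first.
  move=> i _; rewrite -[coords _]/(resample_fun _ t) /resample_fun.
  by rewrite subr_eq0.
apply: leq_trans (sum_jumps n.+1 (v := v) _ _ v1) _.
- by rewrite /v cum0 collapse0.
- by move=> i; apply/collapse_homo/cum_leS.
(* The possible jump ending at 1 uses up the extra 1 allowed by [rpoint_filtration]. The last
   summand is zero because [v n.+1 = 1] is not interior, which leaves [n] terms. *)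
rewrite -[leqRHS]addn1 leq_add ?leq_b1// big_ord_recr /=.
have -> : v n.+1 = 1 by rewrite /v (cum_full t (ltnSn n)) collapse1.
rewrite ltxx andbF addn0.
apply: leq_sum => i _.
by case: (boolP (0 < v i.+1 < 1)) => // /(collapse_param_inside pI) ->.
Qed.

Lemma disjoint_cubes_filtration (R : realType) (Z : simplicialSpace) m
    (c : little_space R m) k (x : realization R Z) :
  simplicial_filtration k x ->
  product_filtration (@simplicial_filtration R Z) k
    (fun i => rescale (collapse_param (cubes (little_incl c) i)) x :
       realization R Z).
Proof.
move=> [n [z [t [nk ->]]]].
pose inside (i : 'I_m) (k : 'I_n) := let p := cubes (little_incl c) i in
  (p.1 < cum t k.+1 < p.2)%R.
exists (fun i => \sum_(k < n) inside i k)%N; split; last first.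
  by move=> i; apply: rescale_filtration; exact: overlapping_spaceP.
(* Count by cumulative sums rather than by intervals: each of the [n] sums lies in at most one of
   the disjoint open intervals. *)
rewrite exchange_big (leq_trans _ nk)// -[leqRHS]card_ord -sum1_card.
apply: leq_sum => j _.
have [i0 i0P|none] := pickP (inside^~ j); last first.
  by rewrite big1// => i _; rewrite none.
rewrite (bigD1 i0)//= i0P big1// => i ii0.
case: (boolP (inside i j)) => // iP; case/eqP: ii0.
by apply: (@little_space_inj _ _ c i i0 (cum t j.+1)); rewrite /= in_itv.
Qed.

(** * The coaction and its properties *)

Definition rescale_coact (R : realType) (Z : simplicialSpace) n
    (c : overlapping_space R n) (x : realization R Z) :
    {ptws 'I_n -> realization R Z} :=
  fun i => rescale (collapse_param (cubes c i)) x.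

Lemma rescale_coact_continuous (R : realType) (Z : simplicialSpace) n :
  continuous (fun p : realization R Z * overlapping_space R n =>
    rescale_coact p.2 p.1).
Proof.
apply: ptws_continuous => i p.
apply: (@continuous_comp _ _ _
  (fun p : realization R Z * overlapping_space R n =>
     (p.1, collapse_param (cubes p.2 i)))
  (fun p : realization R Z * (R * R) => rescale p.2 p.1)).
  apply: continuous_pair; first exact: cvg_fst.
  apply: (@continuous_comp _ _ _
    (fun p : realization R Z * overlapping_space R n => cubes p.2 i)
    (@collapse_param R)).
    apply: (@continuous_comp _ _ _ snd (fun c => cubes c i)).
      exact: cvg_snd.
    apply: (@continuous_comp _ _ _ (@cubes R n) (fun f => f i)).
      exact: initial_continuous.
    exact: ptws_eval_continuous.
  (* Continuity of [collapse_param] is available only at intervals, hence the argument at a fixed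
     point [p]. *)
  exact/collapse_param_continuous/overlapping_spaceP.
exact: rescale_continuous.
Qed.

Lemma rescale_coact_continuous_l (R : realType) (Z : simplicialSpace) n
    (c : overlapping_space R n) : continuous (@rescale_coact R Z n c).
Proof.
move=> x; apply: (@continuous_comp _ _ _
  (fun x : realization R Z => (x, c))
  (fun p : realization R Z * overlapping_space R n => rescale_coact p.2 p.1)).
  by apply: continuous_pair; [exact: cvg_id|exact: cst_continuous].
exact: rescale_coact_continuous.
Qed.

Definition rescale_mapping (R : realType) (Z : simplicialSpace) n
    (c : overlapping_space R n) : Endop (realization R Z) n :=
  mk_mapping (@rescale_coact_continuous_l R Z n c).

Lemma mapping_spaceP (X Y : topologicalType) (f g : mapping_space X Y) :
  mapping_fun f =1 mapping_fun g -> f = g.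
Proof. by move=> fg; apply/continuousEP. Qed.

(** Currying a jointly continuous map yields a continuous map into the compact-open topology, from
    which the mapping space gets its initial topology. *)
Lemma rescale_mapping_continuous (R : realType) (Z : simplicialSpace) n :
  continuous (@rescale_mapping R Z n).
Proof.
apply: continuous_comp_initial.
pose f (p : overlapping_space R n * realization R Z) := rescale_coact p.1 p.2.
suff fc : continuous f by exact: (continuous_curry_fun fc).
move=> p; apply: (@continuous_comp _ _ _
  (fun p : overlapping_space R n * realization R Z => (p.2, p.1))
  (fun p : realization R Z * overlapping_space R n => rescale_coact p.2 p.1)).
  by apply: continuous_pair; [exact: cvg_snd|exact: cvg_fst].
exact: rescale_coact_continuous.
Qed.

Lemma rescale_id (R : realType) (Z : simplicialSpace) (x : realization R Z) :
  rescale (collapse_param (0, 1)) x = x.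
Proof.
by move: x; apply: realization_ind => n z t; rewrite rescaleE resample_id.
Qed.

Lemma rescale_comp (R : realType) (Z : simplicialSpace) (p q : R * R)
    (x : realization R Z) : is_interval p -> is_interval q ->
  rescale (collapse_param (incr_comp p q)) x =
  rescale (collapse_param q) (rescale (collapse_param p) x).
Proof.
move=> pI qI; move: x; apply: realization_ind => n z t.
by rewrite !rescaleE resample_comp.
Qed.

(** Rescaling changes only the simplex coordinate of a cell, a simplicial map only the other one. *)
Lemma rescale_natural (R : realType) (Z W : simplicialSpace)
    (F : simplicialMap Z W) q (x : realization R Z) :
  rescale q (realization_map F x) = realization_map F (rescale q x).
Proof.
move: x; apply: realization_ind => n z t.
by rewrite rescaleE !realization_mapE rescaleE.
Qed.

Program Definition rescale_operad_map (R : realType) (Z : simplicialSpace) :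
    operad_map (Overlapping R) (Endop (realization R Z)) :=
  @OperadMap (Overlapping R) (Endop (realization R Z))
    (@rescale_mapping R Z) _ _ _ _.
Next Obligation. by move=> R Z n; exact: rescale_mapping_continuous. Qed.
Next Obligation.
move=> R Z; apply: mapping_spaceP => x; apply/funext => i; exact: rescale_id.
Qed.
Next Obligation.
move=> R Z n m a i b; apply: mapping_spaceP => x; apply/funext => k.
rewrite -[LHS]/(rescale (collapse_param (overlapping_comp_fun a i b k)) x).
rewrite -[RHS]/(splice i (rescale_coact a x)
  (rescale_coact b (rescale_coact a x i)) k).
(* Outside the inserted block the two sides agree by definition; inside it, the reversal in
   [rescale_comp] matches the reversed composition of [Endop]. *)
rewrite /overlapping_comp_fun /splice; case: splice_index => // j.
by apply: rescale_comp; exact: overlapping_spaceP.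
Qed.
Next Obligation. by move=> R Z n s a; apply: mapping_spaceP. Qed.

Definition rescale_coaction (R : realType) (Z : simplicialSpace) :
    coaction (Overlapping R) (realization R Z) :=
  @Coaction (Overlapping R) (realization R Z) (rescale_operad_map R Z)
    (@rescale_coact_continuous R Z).

Theorem theorem10p2 (R : realType) :
  exists th : forall Z : simplicialSpace,
      coaction (Overlapping R) (realization R Z),
    natural_coaction th /\
    (forall Z : simplicialSpace,
      diagonal_coaction (coaction_comp (th Z) (com_to_overlapping R)) /\
      filtered_coaction (@simplicial_filtration R Z)
        (coaction_comp (th Z) (little_to_overlapping R))).
Proof.
exists (rescale_coaction R); split.
  by move=> Z W F n x a i; exact: rescale_natural.
move=> Z; split.
  by move=> n x a; apply/funext => i; exact: rescale_id.
by move=> n k x c; exact: disjoint_cubes_filtration.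
Qed.
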